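(* (Gauss–Green's formula) Let $M\ge 0$. For $u,v\in\mathcal{D}_M$, $$\int_{\Sigma_N^+}\left(v\,\Delta u-u\,\Delta v\right)\mathrm{d}\mu=\sum_{p\in V_M}\big(v(p)\,(du)(p)-u(p)\,(dv)(p)\big).$$
   Context: Fix an integer $N\ge 2$, $S=\{1,\dots,N\}$, and let $\Sigma_N^+=\{x=(x_1x_2\cdots):x_i\in S\}$ with the product topology. Cylinder sets: $[p_1\cdots p_m]=\{x: x_1=p_1,\dots,x_m=p_m\}$. $\mu$ is the Borel probability measure with $\mu([p_1\cdots p_m])=N^{-m}$. $\mathcal{C}(\Sigma_N^+)$ is the set of real continuous functions. For $m\ge 0$, $V_m$ is the set of sequences $p=(p_1\cdots p_m\,p_{m+1}\,p_{m+1}\cdots)$ that are constant from position $m+1$ on; $V_0\subset V_1\subset\cdots$, and $V_{-1}=\emptyset$. For $p\in V_m$, $\mathcal{U}_{p,m}=\{q\in V_m: q\ne p,\ q_i=p_i \text{ for } 1\le i\le m\}$ (a set of $N-1$ points; for $m=0$ it is $V_0\setminus\{p\}$). For $p\in\bigcup_m V_m$, $\kappa_p=\min\{j:p\in V_j\}$. For a real function $u$ defined (at least) on $V_m$ and $p\in V_m$, the difference operator is $$H_m u(p)=\sum_{j=\kappa_p}^{m}\ \sum_{q\in\mathcal{U}_{p,j}}(u(q)-u(p)).$$ Laplacian: for $u,f\in\mathcal{C}(\Sigma_N^+)$, $\Delta u=f$ means $\lim_{m\to\infty}\max_{p\in V_m\setminus V_{m-1}}\left|\frac{H_mu(p)}{\mu([p_1\cdots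 p_{m+1}])}-f(p)\right|=0$. $D_\mu$ is the set of $u\in\mathcal{C}(\Sigma_N^+)$ for which such an $f$ exists. For $M\ge0$, $\mathcal{D}_M$ is the set of $u\in D_\mu$ for which there is $f\in\mathcal{C}(\Sigma_N^+)$ with $\Delta u=f$ and $\lim_{m\to\infty}\max_{p\in V_m\setminus V_M}\left|\frac{H_mu(p)}{\mu([p_1\cdots p_{m+1}])}-f(p)\right|=0$. Neumann derivative: for $u\in\mathcal{D}_M$ and $p\in V_M$, $(du)(p):=\lim_{m\to\infty}-H_mu(p)$ (this limit exists). *)

(* Defs.v *)
From HB Require Import structures.
From mathcomp Require Import all_boot all_order all_algebra.
From mathcomp Require Import all_classical all_reals all_analysis.

Set Implicit Arguments.
Unset Strict Implicit.
Unset Printing Implicit Defensive.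

Import Order.TTheory GRing.Theory Num.Theory.
Import numFieldNormedType.Exports.

Local Open Scope classical_set_scope.
Local Open Scope ring_scope.

(* The symbols 1, ..., N are represented by 0, ..., N - 1.  The argument hN is
   only used to make the type pointed, as required by measurableType. *)
Definition alphabet (N : nat) (hN : (2 <= N)%N) : Type := 'I_N.

Section alphabet_instances.
Variables (N : nat) (hN : (2 <= N)%N).

HB.instance Definition _ := Finite.copy (alphabet hN) 'I_N.
HB.instance Definition _ :=
  isPointed.Build (alphabet hN) (Ordinal (ltnW hN)).
HB.instance Definition _ := hasNbhs.Build (alphabet hN) principal_filter.
HB.instance Definition _ := Discrete_ofNbhs.Build (alphabet hN) erefl.

End alphabet_instances.

(* One-sided sequences with the product topology and the Borel sigma-algebra;
   the coordinate x_(i+1) of x is (x i). *)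
Definition shift_space (N : nat) (hN : (2 <= N)%N) : Type :=
  prod_topology (fun _ : nat => alphabet hN).

Section shift_space_instances.
Variables (N : nat) (hN : (2 <= N)%N).

HB.instance Definition _ := Pointed.on (shift_space hN).
HB.instance Definition _ := Topological.on (shift_space hN).
HB.instance Definition _ := Measurable.copy (shift_space hN)
  (g_sigma_algebraType (@open (shift_space hN))).

End shift_space_instances.

Section difference_operators.
Variables (N : nat) (hN : (2 <= N)%N).
Local Notation X := (shift_space hN).
Implicit Types (p q : X) (m : nat).

(* The cylinder [p_1 ... p_m]; every word of length m is a prefix of some p. *)
Definition cylinder p m : set X :=
  [set x | forall i, (i < m)%N -> x i = p i].

Definition V m : set X := [set p | forall i, (m <= i)%N -> p i = p m].

(* V_(m-1), with V_(-1) empty *)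
Definition Vprev m : set X := if m is k.+1 then V k else set0.

Definition U p m : set X :=
  [set q | [/\ V m q, q <> p & forall i, (i < m)%N -> q i = p i]].

(* min {j | p \in V j}; 0 when p is in no V j *)
Definition kappa p : nat :=
  xget 0%N [set j | V j p /\ forall i, V i p -> (j <= i)%N].

(* The sets V m, and hence U p m, are finite (so that \sum_(q \in _) is the
   actual sum). *)
Lemma finite_V m : finite_set (V m).
Proof.
pose ext (t : {ffun 'I_m.+1 -> 'I_N}) : X := fun i => t (inord (minn i m)).
have sub : V m `<=` range ext.
  move=> p Vp; exists [ffun i : 'I_m.+1 => p i] => //.
  apply: funext => i; rewrite /ext ffunE inordK ?ltnS ?geq_minr//.
  by rewrite /minn; case: ltnP => // mi; rewrite Vp.
by apply: (sub_finite_set sub); apply: finite_image; exact: finite_finset.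
Qed.

Variable R : realType.
Implicit Types u f : X -> R.

Definition H m u p : R :=
  \sum_(kappa p <= j < m.+1) \sum_(q \in U p j) (u q - u p).

Variable mu : {measure set X -> \bar R}.

(* max over p in A of |H_m u(p) / mu([p_1 ... p_(m+1)]) - f(p)|; 0 if A is
   empty *)
Definition max_deviation (A : set X) m u f : R :=
  \big[Num.max/0]_(p \in A)
    `| H m u p / fine (mu (cylinder p m.+1)) - f p |.

(* Delta u = f *)
Definition is_laplacian u f : Prop :=
  [/\ continuous u, continuous f &
      max_deviation (V m `\` Vprev m) m u f @[m --> \oo] --> (0 : R)].

Definition Dmu : set (X -> R) := [set u | exists f, is_laplacian u f].

Definition DM (M : nat) : set (X -> R) :=
  [set u | Dmu u /\ exists f, is_laplacian u f /\
    max_deviation (V m `\` V M) m u f @[m --> \oo] --> (0 : R)].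

Definition neumann u p : R := lim (- H m u p @[m --> \oo]).

End difference_operators.

(* Main.v *)
Require Import Defs.
From HB Require Import structures.
From mathcomp Require Import all_boot all_order all_algebra.
From mathcomp Require Import all_classical all_reals all_analysis.
From mathcomp Require Import finmap measurable_realfun ring lra.

Set Implicit Arguments.
Unset Strict Implicit.
Unset Printing Implicit Defensive.

Import Order.TTheory GRing.Theory Num.Theory.
Import numFieldNormedType.Exports.

Local Open Scope classical_set_scope.
Local Open Scope ring_scope.

(** Write [A_m(w, u)] for the sum of [w p * H_m u p] over [p] in [V m].

    The operator [H_m] is a sum, over the levels [j <= m], of graph Laplacians:
    at level [j], two distinct points of [V j] are adjacent when they share
    their first [j] letters, so that [V j] splits into complete graphs (the
    blocks, each with [N] points).  Adjacency is symmetric, hence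
    [A_m(v, u) = A_m(u, v)] for all [m] ([H_sym]); the formula is the limit of
    this identity.

    The limit of [A_m(w, u)] for [w] continuous and [Delta u = f] is computed in
    [green_cvg]. For [u] in [DM mu M], outside [V M], [H_m u p] is [f p / N ^
    m.+1] up to an error that is uniformly small with respect to [1 / N ^ m.+1],
    and [V m] has [N ^ m.+1] points, so that part of the sum has the same limit
    as the Riemann sums of [w * f], which converge to the integral by dominated
    convergence ([riemann_sum_cvg]). On the finite set [V M], [H_m u p]
    converges to [- neumann u p] ([H_cvg]): the increment [H_m.+1 u p - H_m u p]
    is the level difference at [p], and level differences sum to zero over a
    block, so the increment is minus the sum of [H_m.+1 u q] over the other
    points [q] of the block. Those points are new, hence the Laplacian controls
    [H_m.+1 u q], and the increments decay geometrically.

    The function [f] that witnesses the membership of [u] in [DM mu M] is the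
    given one, because the new points [V m.+1 \ V m] accumulate at every
    sequence ([laplacian_unique]). *)

(** * The space of sequences *)

Section sequence_space.
Variables (N : nat) (hN : (2 <= N)%N).
Local Notation X := (shift_space hN).
Implicit Types (p q x : X) (m i : nat).

Lemma cvg_shift_space (y : nat -> X) x :
  (forall m i, (i < m)%N -> y m i = x i) -> y @ \oo --> x.
Proof.
move=> yx; apply/cvg_sup => i A.
case=> B [[C oC <-] /= Cx sBA]; exists i.+1 => // m /= im; apply: sBA => /=.
by rewrite /proj yx.
Qed.

Lemma compact_shift_space : compact [set: X].
Proof.
have := @tychonoff nat (fun=> alphabet hN) (fun=> setT)
  (fun=> finite_compact (@finite_finset (alphabet hN) _)).
by congr compact; apply/seteqP; split.
Qed.

Lemma open_cylinder p m : open (cylinder p m).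
Proof.
elim: m => [|m IH].
  rewrite (_ : cylinder p 0 = setT); first exact: openT.
  by apply/seteqP; split => // x _ i; rewrite ltn0.
rewrite (_ : cylinder p m.+1 = cylinder p m `&` (proj m @^-1` [set p m])).
  apply: openI => //; apply: open_comp; last exact: discrete_open.
  by move=> x _; exact: proj_continuous.
apply/seteqP; split => x /=.
  by move=> h; split; [move=> i im; apply: h; exact: ltnW | exact: h].
by move=> [h1 h2] i; rewrite ltnS leq_eqVlt => /orP[/eqP ->//|/h1].
Qed.

Lemma measurable_cylinder p m : measurable (cylinder p m).
Proof. by apply: sub_sigma_algebra; exact: open_cylinder. Qed.

(** The point of [V m] with the same letters as [x] up to the index [m], that
    is, the first [m.+1] letters; the last of them is then repeated. *)
Definition trunc m x : X := fun i => x (minn i m).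

Lemma V_trunc m x : V m (trunc m x).
Proof. by move=> i mi; rewrite /trunc minnn (minn_idPr mi). Qed.

Lemma V_le m k p : (m <= k)%N -> V m p -> V k p.
Proof. by move=> mk Vp i ki; rewrite !Vp// (leq_trans mk). Qed.

Lemma trunc_cylinder m p x : V m p -> cylinder p m.+1 x -> trunc m x = p.
Proof.
move=> Vp px; apply: funext => i; rewrite /trunc px ?ltnS ?geq_minr//.
by rewrite /minn; case: ltnP => // /Vp.
Qed.

Lemma cylinder_trunc m x : cylinder (trunc m x) m.+1 x.
Proof. by move=> i; rewrite ltnS /trunc => /minn_idPl ->. Qed.

Lemma cvg_trunc x : trunc ^~ x @ \oo --> x.
Proof.
by apply: cvg_shift_space => m i im; rewrite /trunc (minn_idPl (ltnW im)).
Qed.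

Variable R : realType.

Lemma continuous_bounded (h : X -> R) : continuous h ->
  exists2 C : R, 0 <= C & forall x, `|h x| <= C.
Proof.
move=> ch; have /compact_bounded[C [_ hC]] : compact (h @` setT).
  apply: continuous_compact compact_shift_space.
  exact: continuous_subspaceT.
exists (`|C| + 1) => [|x]; first by rewrite addr_ge0.
by apply: hC; [rewrite (le_lt_trans (ler_norm _))// ltrDl|exists x].
Qed.

Lemma continuous_mulr (g h : X -> R) : continuous g -> continuous h ->
  continuous (fun x => g x * h x).
Proof. by move=> cg ch x; exact (cvgM (cg x) (ch x)). Qed.

Lemma measurable_continuous (h : X -> R) : continuous h ->
  measurable_fun [set: (X : measurableType _)] h.
Proof.
move=> /continuousP ch; apply: (measurability _ (RGenOpens.measurableE R)).
move=> _ [_ [a [b ->] <-]]; rewrite setTI; apply: sub_sigma_algebra.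
exact: ch (interval_open _ _).
Qed.

End sequence_space.

(** * Finite sums *)

Section finite_sums.
Variables (T : choiceType) (R : realFieldType).
Implicit Types (A : set T) (F G : T -> R).

Lemma ler_fsum A F G : finite_set A -> (forall x, A x -> F x <= G x) ->
  \sum_(x \in A) F x <= \sum_(x \in A) G x.
Proof.
move=> fA FG; rewrite !fsbig_finite// !big_seq; apply: ler_sum => x.
by rewrite in_fset_set// => /set_mem /FG.
Qed.

Lemma ler_norm_fsum A F : finite_set A ->
  `|\sum_(x \in A) F x| <= \sum_(x \in A) `|F x|.
Proof. by move=> fA; rewrite !fsbig_finite//; exact: ler_norm_sum. Qed.

Lemma fsumrN A F : \sum_(x \in A) - F x = - \sum_(x \in A) F x.
Proof.
rewrite -mulN1r mulr_fsumr; apply: eq_fsbigr => x _; exact/esym/mulN1r.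
Qed.

Lemma fsum_antisym A (F : T -> T -> R) : finite_set A ->
  (forall x y, A x -> A y -> F y x = - F x y) ->
  \sum_(x \in A) \sum_(y \in A) F x y = 0.
Proof.
move=> fA FN; set S := LHS; suff /eqP : S = - S.
  by rewrite -addr_eq0 -mulr2n mulrn_eq0 /= => /eqP.
rewrite {1}/S exchange_fsbig// /S -fsumrN; apply: eq_fsbigr => x /set_mem Ax.
by rewrite -fsumrN; apply: eq_fsbigr => y /set_mem Ay; exact: FN.
Qed.

End finite_sums.

Lemma cvg_fsum (R : realType) (T : choiceType) (D : set T) (F : nat -> T -> R)
    (l : T -> R) :
  finite_set D -> (forall t, D t -> F m t @[m --> \oo] --> l t) ->
  \sum_(t \in D) F m t @[m --> \oo] --> \sum_(t \in D) l t.
Proof.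
move=> fD Fl; rewrite fsbig_finite// big_seq.
rewrite (_ : (fun m => _) =
  fun m => \sum_(t <- fset_set D | t \in fset_set D) F m t).
  apply: cvg_big => [|t]; first exact: add_continuous.
  by rewrite in_fset_set// => /set_mem; exact: Fl.
by apply: funext => m; rewrite fsbig_finite// [LHS]big_seq.
Qed.

(** * Riemann sums over V m *)

Section riemann_sums.
Variables (R : realType) (N : nat) (hN : (2 <= N)%N).
Local Notation X := (shift_space hN).
Variable mu : probability X R.
Hypothesis mu_cylinder :
  forall (p : X) m, mu (cylinder p m) = (N%:R ^- m)%:E.
Implicit Types (h : X -> R) (m : nat).

(** [h \o trunc m] is a step function: the cylinders of the points of [V m],
    of length [m.+1], partition the space. *)
Lemma comp_trunc h m x :
  h (trunc m x) = \sum_(p \in V m) h p * \1_(cylinder p m.+1) x.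
Proof.
have fV := finite_V hN m.
rewrite (fsbigD1 (trunc m x))//; last exact: V_trunc.
rewrite indicE mem_set ?mulr1; last exact: cylinder_trunc.
rewrite fsbig1 ?Monoid.simpm// => p [Vp px]; rewrite indicE memNset ?mulr0//.
by move=> /(trunc_cylinder Vp)/esym.
Qed.

Lemma measurable_comp_trunc h m :
  measurable_fun [set: (X : measurableType _)] (h \o trunc m).
Proof.
rewrite (_ : _ \o _ =
  fun x => \sum_(p <- fset_set (V m)) h p * \1_(cylinder p m.+1) x).
  apply: measurable_sum => p; apply: measurable_funM => //.
  by apply: measurable_indic; exact: measurable_cylinder.
by apply: funext => x /=; rewrite comp_trunc fsbig_finite//; exact: finite_V.
Qed.

Lemma integral_comp_trunc h m :
  (\int[mu]_x (h (trunc m x))%:E)%E =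
  (\sum_(p \in V m) h p * N%:R ^- m.+1)%:E.
Proof.
have fV := finite_V hN m.
have mC (p : X) := measurable_cylinder p m.+1.
have iC (p : X) : mu.-integrable setT (EFin \o \1_(cylinder p m.+1)).
  by apply: integrable_indic => //; rewrite setIT mu_cylinder ltry.
under eq_integral do rewrite comp_trunc fsbig_finite// -sumEFin.
rewrite fsbig_finite// -sumEFin.
rewrite (@integral_sum _ _ _ mu setT _ _
  (fun p x => (h p * \1_(cylinder p m.+1) x)%:E))//; last first.
  by move=> p; apply: (integrableZl measurableT (h p) (iC p)).
apply: eq_bigr => p _; under eq_integral do rewrite EFinM.
rewrite (integralZl measurableT (iC p)) integral_indic// setIT.
by rewrite EFinM; congr (_ * _)%E; exact: mu_cylinder.
Qed.

Lemma integrable_continuous h : continuous h ->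
  mu.-integrable setT (EFin \o h).
Proof.
move=> ch; apply: measurable_bounded_integrable => //.
- by rewrite -ge0_fin_numE//; exact: fin_num_measure.
- exact: measurable_continuous.
have [C _ hC] := continuous_bounded ch.
exists C; split; first exact: num_real.
by move=> x Cx y _ /=; rewrite (le_trans (hC y))// ltW.
Qed.

Lemma riemann_sum_cvg h : continuous h ->
  \sum_(p \in V m) h p * N%:R ^- m.+1 @[m --> \oo] -->
  fine (\int[mu]_x (h x)%:E)%E.
Proof.
move=> ch; have ih := integrable_continuous ch.
have [C _ hC] := continuous_bounded ch.
have iC := finite_measure_integrable_cst mu C measurableT.
have [//|||||_ _] := @dominated_convergence _ _ _ mu setT measurableT
  (fun m x => (h (trunc m x))%:E) (EFin \o h) (EFin \o cst C).
- by move=> m; apply/measurable_EFinP; exact: measurable_comp_trunc.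
- by apply/measurable_EFinP; exact: measurable_continuous.
- apply: aeW => x _; apply: cvg_EFin; first exact: nearW.
  by apply: (cvg_comp _ _ (@cvg_trunc _ _ x)); exact: ch.
- exact: iC.
- by apply: aeW => x m _; rewrite abse_EFin lee_fin.
rewrite (_ : (fun m => _) =
  fine \o (fun m => \int[mu]_x (h (trunc m x))%:E)%E).
  move=> cvgi; apply: fine_cvg.
  by rewrite fineK//; exact: (integrable_fin_num measurableT ih).
by apply: funext => m /=; rewrite integral_comp_trunc.
Qed.

(** This holds because [V m] has [N ^ m.+1] points. *)
Lemma fsum_V_cst (c : R) m :
  \sum_(p \in (V m : set X)) c * N%:R ^- m.+1 = c.
Proof.
apply: EFin_inj; rewrite -(integral_comp_trunc (fun=> c)) integral_cst//.
by rewrite -[RHS]mule1; congr (_ * _)%E; exact: probability_setT.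
Qed.

End riemann_sums.

(** * The difference operator *)

Section difference_operator.
Variables (R : realType) (N : nat) (hN : (2 <= N)%N).
Local Notation X := (shift_space hN).
Implicit Types (p q x : X) (u w : X -> R) (m j : nat).

Lemma kappa_leP m p j : V m p -> reflect (V j p) (kappa p <= j)%N.
Proof.
move=> Vmp; have exV : exists j, `[< V j p >] by exists m; apply/asboolP.
have [k /asboolP Vk kmin] := ex_minnP exV.
have kP : [set j | V j p /\ forall i, V i p -> (j <= i)%N] k.
  by split => // i /asboolP; exact: kmin.
rewrite /kappa; have [Vkp kappa_min] := xgetPex 0%N (ex_intro _ k kP).
by apply: (iffP idP) => [le|]; [exact: V_le le Vkp|exact: kappa_min].
Qed.

(** The term of level [j] in [H]; it is meant for [p] in [V j]. *)
Definition level_diff j u p : R := \sum_(q \in U p j) (u q - u p).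

(** For [p] in [V j], the vertices of the complete graph of level [j] around
    [p], including [p] itself. *)
Definition block j p : set X := V j `&` cylinder p j.

Lemma finite_block j p : finite_set (block j p).
Proof. by apply: finite_setIl; exact: finite_V. Qed.

Lemma U_block p j : U p j = block j p `\ p.
Proof. by apply/seteqP; split => q /= [] => [? ? ?|[? ?] ?]; split. Qed.

Lemma block_refl j p : V j p -> block j p p.
Proof. by []. Qed.

Lemma block_eq j p q : block j p q -> block j q = block j p.
Proof.
move=> [_ pq]; rewrite /block; congr (_ `&` _); apply/seteqP.
by split => x xq i ij; rewrite xq// pq.
Qed.

Lemma level_diffE j u p : V j p ->
  level_diff j u p = \sum_(q \in block j p) (u q - u p).
Proof.
move=> Vp; rewrite /level_diff U_block [RHS](fsbigD1 p)//.
  by rewrite subrr Monoid.simpm.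
exact: finite_block.
Qed.

Lemma level_diff_sum0 j u p : V j p ->
  \sum_(q \in block j p) level_diff j u q = 0.
Proof.
move=> Vp; rewrite -[RHS](@fsum_antisym _ _ (block j p) (fun x y => u y - u x)).
- apply: eq_fsbigr => q /set_mem pq; rewrite level_diffE; last by case: pq.
  by rewrite (block_eq pq).
- exact: finite_block.
- by move=> x y _ _; rewrite opprB.
Qed.

(** A block has [N] points, one for each letter at the index [j]. *)
Lemma sum_block_cst j p (c : R) : V j p -> \sum_(q \in block j p) c = N%:R * c.
Proof.
move=> Vp; pose ext (a : 'I_N) : X := fun i => if (i < j)%N then p i else a.
rewrite (reindex_fsbig ext setT); last first.
  split.
  - move=> a _; split; first by move=> i ji; rewrite /ext ltnn ltnNge ji.
    by move=> i ij; rewrite /ext ij.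
  - by move=> a b _ _ /(congr1 (fun x : X => x j)); rewrite /ext ltnn.
  - move=> q [Vq pq]; exists (q j : 'I_N) => //; apply: funext => i.
    by rewrite /ext; case: ltnP => [/pq//|/Vq].
rewrite (_ : setT = [set` enum 'I_N]); last first.
  by apply/seteqP; split => // a _ /=; rewrite mem_enum.
by rewrite -fsbig_seq ?enum_uniq// big_enum sumr_const card_ord mulr_natl.
Qed.

Lemma H_succ m u p : V m p -> H m.+1 u p = H m u p + level_diff m.+1 u p.
Proof.
move=> Vp; rewrite /H big_nat_recr//=; apply/(kappa_leP _ Vp).
exact: V_le Vp.
Qed.

Lemma H_new m u q : V m.+1 q -> ~ V m q -> H m.+1 u q = level_diff m.+1 u q.
Proof.
move=> Vq nVq; rewrite /H (_ : kappa q = m.+1) ?big_nat1//.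
apply/eqP; rewrite eqn_leq; apply/andP; split; first exact/(kappa_leP _ Vq).
by rewrite ltnNge; apply/negP => /(kappa_leP _ Vq).
Qed.

Lemma U_new m p q : V m p -> U p m.+1 q -> ~ V m q.
Proof.
move=> Vp [_ qp pq] Vq; apply: qp; apply: funext => i.
have [im|mi] := ltnP i m; first by rewrite pq// ltnW.
by rewrite Vq// Vp// pq.
Qed.

(** The differences [u y - u x] cancel in pairs over the block of [p], and the
    points of this block other than [p] are not in [V m]. *)
Lemma level_diff_new m u p : V m p ->
  level_diff m.+1 u p = - \sum_(q \in U p m.+1) H m.+1 u q.
Proof.
move=> Vp; have Vp1 : V m.+1 p by exact: V_le Vp.
have := level_diff_sum0 u Vp1; rewrite (fsbigD1 p)//; last exact: finite_block.
rewrite -U_block => /eqP; rewrite addr_eq0 => /eqP ->; congr (- _).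
apply: eq_fsbigr => q /set_mem Uq; rewrite H_new//; first by case: Uq.
exact: U_new Uq.
Qed.

Lemma level_diff_sym j u w :
  \sum_(p \in V j) w p * level_diff j u p =
  \sum_(p \in V j) u p * level_diff j w p.
Proof.
have fV := finite_V hN j.
pose F p q : R := if q \in block j p then w p * u q - u p * w q else 0.
apply/eqP; rewrite -subr_eq0 -fsumrN -fsbig_split//=.
rewrite -[X in _ == X](@fsum_antisym _ _ (V j) F)//; last first.
  move=> p q Vp Vq; rewrite /F.
  have -> : (p \in block j q) = (q \in block j p).
    by apply/idP/idP => /set_mem pq; apply/mem_set; rewrite (block_eq pq).
  by case: ifP; rewrite ?oppr0// opprB [w q * _]mulrC [u q * _]mulrC.
apply/eqP/eq_fsbigr => p /set_mem Vp; rewrite !level_diffE//.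
rewrite -fsbig_mkcondr (_ : V j `&` _ = block j p); last first.
  by rewrite /block setIA setIid.
rewrite !mulr_fsumr -fsumrN -fsbig_split//=; last exact: finite_block.
apply: eq_fsbigr => q _; rewrite !mulrBr opprB [u p * w p]mulrC.
by rewrite addrA subrK.
Qed.

(** Each level [j <= m] occurs in [H m u p] exactly when [p] is in [V j], so
    the sum over [V m] splits into sums over the graphs of the levels. *)
Lemma H_sym m u w :
  \sum_(p \in V m) w p * H m u p = \sum_(p \in V m) u p * H m w p.
Proof.
have HE (v z : X -> R) : \sum_(p \in V m) z p * H m v p =
    \sum_(j < m.+1) \sum_(p \in V j) z p * level_diff j v p.
  transitivity (\sum_(p \in V m) \sum_(j < m.+1)
      if p \in V j then z p * level_diff j v p else 0).
    apply: eq_fsbigr => p /set_mem Vp; rewrite /H big_distrr /=.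
    rewrite (big_nat_widenl _ 0)// big_mkord big_mkcond; apply: eq_bigr => j _.
    congr (if _ then _ else _).
    by apply/(kappa_leP _ Vp)/idP => [/mem_set|/set_mem].
  rewrite fsbig_finite; last exact: finite_V.
  rewrite exchange_big; apply: eq_bigr => j _.
  rewrite -fsbig_finite; last exact: finite_V.
  rewrite -fsbig_mkcondr; congr (\sum_(i \in _) _).
  by apply/setIidPr => p; apply: V_le; rewrite -ltnS.
by rewrite !HE; apply: eq_bigr => j _; exact: level_diff_sym.
Qed.

End difference_operator.

(** * Laplacian, Neumann derivative and the limit of A_m *)

Section gauss_green.
Variables (R : realType) (N : nat) (hN : (2 <= N)%N).
Local Notation X := (shift_space hN).
Variable mu : probability X R.
Hypothesis mu_cylinder :
  forall (p : X) m, mu (cylinder p m) = (N%:R ^- m)%:E.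
Implicit Types (p q x : X) (u v w f g : X -> R) (m M : nat) (A : set X).

Let N_gt0 : 0 < N%:R :> R.
Proof. by rewrite ltr0n ltnW. Qed.

Let invN_lt1 : `|N%:R^-1 : R| < 1.
Proof. by rewrite ger0_norm ?invr_ge0 ?ler0n// invf_lt1// ltr1n. Qed.

Lemma max_deviation_ge0 A m u f : 0 <= max_deviation mu A m u f.
Proof. exact: bigmax_ge_id. Qed.

Lemma le_max_deviation A m u f p : finite_set A -> A p ->
  `|H m u p / fine (mu (cylinder p m.+1)) - f p| <= max_deviation mu A m u f.
Proof.
move=> fA Ap; pose F q := `|H m u q / fine (mu (cylinder q m.+1)) - f q|.
rewrite -/(F p).
(* The support of the finite maximum omits the points where [F] vanishes. *)
have [->|Fp] := eqVneq (F p) 0; first exact: max_deviation_ge0.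
apply: (@le_bigmax_seq _ _ _ _ _ _ xpredT F) => //.
rewrite in_finite_support; last exact: finite_setIl.
by apply/mem_set; split => //=; exact/eqP.
Qed.

Lemma H_deviation A m u f p : finite_set A -> A p ->
  `|H m u p - f p * N%:R ^- m.+1| <= max_deviation mu A m u f * N%:R ^- m.+1.
Proof.
move=> fA Ap; have := le_max_deviation m u f fA Ap; rewrite mu_cylinder /=.
have e0 : 0 < N%:R ^- m.+1 :> R by rewrite invr_gt0 exprn_gt0.
rewrite -(ler_pM2r e0) -{2}(gtr0_norm e0) -normrM mulrBl divfK//.
by rewrite lt0r_neq0.
Qed.

(** The sequence [y m] copies [x] up to the index [m] and then repeats a letter
    different from [x m], so that it does not belong to [V m]. *)
Lemma V_new_dense x : exists y : nat -> X,
  (forall m, (V m.+1 `\` V m) (y m)) /\ y @ \oo --> x.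
Proof.
have other (a : 'I_N) : exists b : 'I_N, b <> a.
  case: a => -[|k] lt_aN; first by exists (Ordinal hN).
  by exists (Ordinal (ltnW hN)).
pose b a := projT1 (cid (other a)).
have bP a : b a <> a by rewrite /b; case: cid.
exists (fun m i => if (i <= m)%N then x i else b (x m)); split.
  move=> m; split; first by move=> i mi; rewrite ltnn leqNgt mi.
  move=> /(_ m.+1 (leqnSn _)); rewrite leqnn ltnn; exact: bP.
by apply: cvg_shift_space => m i im; rewrite ltnW.
Qed.

Lemma laplacian_unique u f g :
  is_laplacian mu u f -> is_laplacian mu u g -> f = g.
Proof.
move=> [_ cf uf] [_ cg ug]; apply: funext => x.
have [y [yV yx]] := V_new_dense x.
have yf : f (y m) @[m --> \oo] --> f x by exact: (cvg_comp _ _ yx (cf x)).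
have yg : g (y m) @[m --> \oo] --> g x by exact: (cvg_comp _ _ yx (cg x)).
apply/eqP; rewrite -subr_eq0; apply/eqP.
apply: (cvg_unique (@Rhausdorff R) (cvgB yf yg)).
apply/norm_cvg0P.
pose d h m := max_deviation mu (V m `\` Vprev m) m u h.
apply: (@squeeze_cvgr _ _ _ _ (cst 0) (fun m => d f m.+1 + d g m.+1)).
- apply: nearW => m; rewrite normr_ge0/=.
  have fV : finite_set (V m.+1 `\` Vprev m.+1 : set X).
    by apply: finite_setD; exact: finite_V.
  apply: le_trans (ler_distD
    (H m.+1 u (y m) / fine (mu (cylinder (y m) m.+2))) _ _) _.
  by rewrite distrC lerD//; exact: le_max_deviation.
- exact: cvg_cst.
- rewrite -[0]addr0; apply: cvgD.
    by have := uf; rewrite -cvg_shiftS.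
  by have := ug; rewrite -cvg_shiftS.
Qed.

(** The Neumann derivative exists on [V M]; only the condition [Delta u = f] is
    needed. *)
Lemma H_cvg M u f p : is_laplacian mu u f -> V M p ->
  H m u p @[m --> \oo] --> - neumann u p.
Proof.
move=> [_ cf uf] Vp.
suff cH : cvgn (fun m => H m u p).
  by rewrite /neumann limN// opprK.
suff : cvgn (fun n => H (n + M)%N u p).
  by move=> /cvg_ex[l cl]; apply/cvg_ex; exists l; rewrite -(cvg_shiftn M).
have VMn n : V (n + M)%N p by apply: V_le Vp; rewrite leq_addl.
pose a n := H (n + M)%N u p; rewrite -/a (funext (eq_sum_telescope a)).
apply: is_cvgD; first exact: is_cvg_cst.
pose d m := max_deviation mu (V m `\` Vprev m) m u f.
have [B [_ dB]] := cvg_seq_bounded (cvgP _ uf).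
have [C C0 fC] := continuous_bounded cf.
(* [K] bounds [N%:R ^+ m.+1 * `|H m u q|] for all [m] and all new [q]. *)
pose K : R := `|B| + 1 + C.
have K0 : 0 <= K by rewrite !addr_ge0.
have dK m : d m + C <= K.
  rewrite lerD2r; apply: le_trans (ler_norm _) _.
  by apply: dB => //; rewrite (le_lt_trans (ler_norm _))// ltrDl.
apply: normed_cvg.
have N_neq0 := lt0r_neq0 N_gt0.
apply: (series_le_cvg _ _ _
  (is_cvg_geometric_series (a := K * N%:R ^- M.+1) invN_lt1)).
- by move=> n; exact: normr_ge0.
- move=> n; rewrite /geometric/=.
  by rewrite !(mulr_ge0, exprn_ge0, invr_ge0, ler0n).
(* The other [N - 1] points of the block are bounded by all [N] of them. *)
move=> n; rewrite /geometric/=.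
have -> : telescope a n = level_diff (n + M).+1 u p.
  by rewrite /telescope/= /a addSn H_succ// addrAC subrr add0r.
rewrite level_diff_new// normrN.
set m := (n + M)%N.
have fU : finite_set (U p m.+1).
  by rewrite U_block; apply: finite_setD; exact: finite_block.
apply: le_trans (ler_norm_fsum _ fU) _.
have -> : K * N%:R ^- M.+1 * N%:R^-1 ^+ n = N%:R * (K * N%:R ^- m.+2).
  rewrite -!exprVn /m (_ : (n + M).+2 = (M.+1 + n).+1)%N; last first.
    by rewrite addnC addSn.
  rewrite [in RHS]exprS exprD [RHS]mulrCA [X in _ = K * X]mulrA mulfV//.
  by rewrite mul1r mulrA.
have Vp1 : V m.+1 p by exact: V_le (VMn n).
rewrite -(sum_block_cst _ Vp1).
have -> : block m.+1 p = p |` U p m.+1.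
  by rewrite U_block setD1K//; exact: block_refl.
have e0 : 0 <= K * N%:R ^- m.+2 by rewrite mulr_ge0// invr_ge0 exprn_ge0// ltW.
apply: (@le_trans _ _ (\sum_(q \in U p m.+1) K * N%:R ^- m.+2)).
  apply: ler_fsum => // q Uq.
  have Aq : (V m.+1 `\` Vprev m.+1) q.
    by split; [case: Uq|exact: (U_new (VMn n) Uq)].
  have fA : finite_set (V m.+1 `\` Vprev m.+1 : set X).
    by apply: finite_setD; exact: finite_V.
  rewrite -[H _ _ _](subrK (f q * N%:R ^- m.+2)).
  apply: le_trans (ler_normD _ _) _.
  have i0 : 0 <= N%:R ^- m.+2 :> R by rewrite invr_ge0 exprn_ge0// ltW.
  apply: (@le_trans _ _ ((d m.+1 + C) * N%:R ^- m.+2)); last first.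
    by rewrite ler_wpM2r.
  rewrite mulrDl lerD//; first exact: H_deviation.
  by rewrite normrM (ger0_norm i0) ler_wpM2r.
rewrite fsbigU0//=; last by move=> q [/= ->] [].
by rewrite fsbig_set1 lerDr.
Qed.

Lemma green_cvg M u f w : continuous w -> is_laplacian mu u f ->
  max_deviation mu (V m `\` V M) m u f @[m --> \oo] --> (0 : R) ->
  \sum_(p \in V m) w p * H m u p @[m --> \oo] -->
  fine (\int[mu]_x (w x * f x)%:E)%E - \sum_(p \in V M) w p * neumann u p.
Proof.
move=> cw uf uM; have [_ cf _] := uf.
have fV m : finite_set (V m : set X) by exact: finite_V.
have fD m : finite_set (V m `\` V M : set X) by exact: finite_setD.
(* [G m] is what remains of the sum when [H m u p] is replaced by
   [f p * N%:R ^- m.+1] outside [V M]. *)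
pose G m := \sum_(p \in V m) w p * f p * N%:R ^- m.+1 +
  (\sum_(p \in V M) w p * H m u p -
   (\sum_(p \in V M) w p * f p) * N%:R ^- m.+1).
have cG : G m @[m --> \oo] -->
    fine (\int[mu]_x (w x * f x)%:E)%E - \sum_(p \in V M) w p * neumann u p.
  apply: cvgD.
    exact: (riemann_sum_cvg mu_cylinder (continuous_mulr cw cf)).
  rewrite -[X in _ --> X]subr0 -fsumrN; apply: cvgB.
    apply: cvg_fsum => // p Vp; rewrite -mulrN; apply: cvgMr.
    exact: (H_cvg uf Vp).
  rewrite -[X in _ --> X](mulr0 (\sum_(p \in V M) w p * f p)); apply: cvgMr.
  have := cvg_expr invN_lt1; rewrite -cvg_shiftS.
  rewrite (_ : [sequence _]_n = fun m => N%:R ^- m.+1)//.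
  by apply: funext => m; rewrite /= exprVn.
pose d m := max_deviation mu (V m `\` V M) m u f.
have [C C0 wC] := continuous_bounded cw.
rewrite -[X in _ --> X]add0r.
rewrite (_ : (fun m => _) =
  (fun m => (\sum_(p \in V m) w p * H m u p - G m) + G m)); last first.
  by apply: funext => m; rewrite subrK.
apply: cvgD => //; apply/norm_cvg0P.
apply: (@squeeze_cvgr _ _ _ _ (cst 0) (fun m => C * d m)); last 2 first.
- exact: cvg_cst.
- by rewrite -[X in _ --> X](mulr0 C); exact: cvgMr.
exists M => // m /= Mm; rewrite normr_ge0/=.
have split_sum (F : X -> R) : \sum_(p \in V m) F p =
    \sum_(p \in V M) F p + \sum_(p \in V m `\` V M) F p.
  rewrite (fsbigID (V M))//; congr (_ + _); congr (\sum_(i \in _) _).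
  by apply/setIidPr => p; exact: V_le.
rewrite /G 2!split_sum.
rewrite (_ : _ - _ = \sum_(p \in V m `\` V M)
    w p * (H m u p - f p * N%:R ^- m.+1)); last first.
  under [in RHS]eq_fsbigr do rewrite mulrBr mulrA.
  rewrite fsbig_split//= fsumrN -mulr_fsuml; ring.
apply: le_trans (ler_norm_fsum _ (fD m)) _.
have e0 : 0 <= N%:R ^- m.+1 :> R by rewrite invr_ge0 exprn_ge0// ltW.
rewrite -[leRHS](fsum_V_cst mu_cylinder _ m) split_sum.
apply: (@le_trans _ _
  (\sum_(p \in (V m `\` V M : set X)) C * d m * N%:R ^- m.+1)).
  apply: ler_fsum => // p Dp; rewrite normrM -mulrA ler_pM//.
  exact: H_deviation.
rewrite lerDr; apply: fsumr_ge0 => p _.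
by rewrite mulr_ge0// mulr_ge0// max_deviation_ge0.
Qed.

Lemma DM_deviation M u f : DM mu M u -> is_laplacian mu u f ->
  max_deviation mu (V m `\` V M) m u f @[m --> \oo] --> (0 : R).
Proof. by move=> [_ [g [ug gM]]] uf; rewrite (laplacian_unique uf ug). Qed.

End gauss_green.

Theorem corollary5p4 (R : realType) (N : nat) (hN : (2 <= N)%N)
    (mu : probability (shift_space hN) R)
    (hmu : forall (p : shift_space hN) (m : nat),
      mu (cylinder p m) = (N%:R ^- m)%:E)
    (M : nat) (u v f g : shift_space hN -> R)
    (hu : DM mu M u) (hv : DM mu M v)
    (huf : is_laplacian mu u f) (hvg : is_laplacian mu v g) :
  (\int[mu]_x (v x * f x - u x * g x)%:E)%E =
  (\sum_(p \in V M) (v p * neumann u p - u p * neumann v p))%:E.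
Proof.
have [cu cf _] := huf; have [cv cg _] := hvg.
have lu := green_cvg hmu cv huf (DM_deviation hu huf).
have := green_cvg hmu cu hvg (DM_deviation hv hvg).
under eq_cvg do rewrite H_sym.
move=> /(cvg_unique (@Rhausdorff R) lu) => {lu} E.
have ci (a b : shift_space hN -> R) : continuous a -> continuous b ->
    mu.-integrable setT (EFin \o (fun x => a x * b x)).
  move=> ca cb; exact: integrable_continuous (continuous_mulr ca cb).
have ivf := ci _ _ cv cf; have iug := ci _ _ cu cg.
under eq_integral do rewrite EFinB.
rewrite integralB_EFin//.
rewrite -(fineK (integrable_fin_num measurableT ivf)).
rewrite -(fineK (integrable_fin_num measurableT iug)).
rewrite -EFinB fsbig_split//=; last exact: finite_V.
rewrite fsumrN; congr EFin; lra.
Qed.
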